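(* There exist universal constants $\ell_l>0$ and $\ell_u>0$ (independent of $n$, $\boldsymbol\varepsilon$ and $P$) such that the following holds for every $n\ge1$ and every $\boldsymbol\varepsilon=(\varepsilon_i)_{i=1}^n\in\mathbb{R}_+^n$ with $\varepsilon_i\le 1$ for all $i$. Let $\mathcal{P}^*$ be the family of all probability distributions $P$ of a real random variable $X$ with $|X|\le\frac12$ almost surely, and let $\theta(P)=\mathbb{E}_{X\sim P}[X]$. (i) (Lower bound) $$\mathcal{L}_l(\mathcal{P}^*,\theta,\boldsymbol\varepsilon)\ \ge\ \ell_l\left(\frac{1}{\sum_{i=1}^n\varepsilon_i^2}\wedge 1\right).$$ (ii) (Upper bound) If the $\varepsilon_i$ are not all zero, there exists an $\boldsymbol\varepsilon$-locally differentially private linear estimator $\hat\theta$ such that, for every $P\in\mathcal{P}^*$, $$\mathbb{E}_{(X_i\sim P)_{i=1}^n,\hat\theta}\left[\left|\hat\theta-\theta(P)\right|^2\right]\ \le\ \frac{\ell_u}{\sum_{i=1}^n\varepsilon_i^2}.$$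
   Context: $\mathbb{R}_+=[0,\infty)$, $x\wedge y=\min\{x,y\}$, and $1/0=+\infty$. The data space is $\mathcal{X}=[-\frac12,\frac12]$, and $X_1,\dots,X_n$ are i.i.d. samples from $P$. Local differential privacy: a randomized channel $\mathcal{C}:\mathcal{X}\to\mathbb{R}$ is $\varepsilon$-locally differentially private if for all $x,x'\in\mathcal{X}$ and all measurable $\mathcal{W}\subseteq\mathbb{R}$, $\mathbb{P}(\mathcal{C}(x)\in\mathcal{W})\le e^{\varepsilon}\,\mathbb{P}(\mathcal{C}(x')\in\mathcal{W})$. An algorithm is $\boldsymbol\varepsilon$-locally differentially private if it takes as input $(\mathcal{C}_i(x_i))_{i=1}^n$ instead of $(x_i)_{i=1}^n$, where $\mathcal{C}_i$ is an $\varepsilon_i$-locally differentially private channel and the channels use independent randomness. Let $\mathcal{Q}_l(\boldsymbol\varepsilon)$ be the class of maps $\mathcal{M}(X_1,\dots,X_n)=(\mathcal{C}_i(X_i))_{i=1}^n$ with each $\mathcal{C}_i$ being $\varepsilon_i$-locally differentially private, and write $\hat X_i=\mathcal{C}_i(X_i)$. Minimax error: $\mathcal{L}_l(\mathcal{P},\theta,\boldsymbol\varepsilon):=\inf_{\hat\theta,\ \mathcal{M}\in\mathcal{Q}_l(\boldsymbol\varepsilon)}\ \sup_{P\in\mathcal{P}}\mathbb{E}\left[|\hat\theta(\hat X_{1:n})-\theta(P)|^2\right]$, where $\hat\theta$ ranges over measurable real-valued (possibly randomized) functions of $\hat X_{1:n}$ and the expectation is over the samples, the channels, and the estimator. Linear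 estimator (local setting): $\hat\theta=\sum_{i=1}^n w_i\hat x_i$ with $\sum_{i=1}^n w_i=1$ and $\hat x_i=x_i+\mathrm{Laplace}(1/\varepsilon_i)$, with independent noises, where $\mathrm{Laplace}(b)$ has density $\frac1{2b}e^{-|z|/b}$. If $\varepsilon_i=0$, user $i$ releases nothing and $w_i=0$. *)

(* Defs.v *)
(* MathComp-Analysis, over an arbitrary R : realType *)
From HB Require Import structures.
From mathcomp Require Import all_boot all_order all_algebra.
From mathcomp Require Import all_classical all_reals all_analysis.
From mathcomp Require Import measurable_realfun.

Set Implicit Arguments.
Unset Strict Implicit.
Unset Printing Implicit Defensive.

Import Order.TTheory GRing.Theory Num.Theory.
Import numFieldNormedType.Exports.

Local Open Scope classical_set_scope.
Local Open Scope ring_scope.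

Section independent_product.
Context d (T : measurableType d) (R : realType).

Definition tuple_cons n (z : T * n.-tuple T) : n.+1.-tuple T :=
  [the n.+1.-tuple T of z.1 :: z.2].

Lemma measurable_tuple_cons n : measurable_fun setT (@tuple_cons n).
Proof. exact: measurable_cons. Qed.

HB.instance Definition _ n := isMeasurableFun.Build _ _ _ _ (@tuple_cons n)
  (@measurable_tuple_cons n).

(* mu ord0 (x) ... (x) mu ord_max, the joint law of n independent variables
   with respective laws mu i. *)
Fixpoint product_law n : ('I_n -> probability T R) ->
    probability (n.-tuple T) R :=
  match n with
  | 0%N => fun=> \d_[tuple]
  | m.+1 => fun mu =>
      distribution (mu ord0 \x product_law (fun i => mu (lift ord0 i)))%E
        (@tuple_cons m)
  end.

End independent_product.

Section kernel_law.
Context d d' (X : measurableType d) (Y : measurableType d') (R : realType).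
Variables (k : R.-pker X ~> Y) (x : X).

Definition kernel_law : set Y -> \bar R := k x.

HB.instance Definition _ := Measure.on kernel_law.

Let kernel_law_setT : kernel_law setT = 1%E.
Proof. exact: prob_kernel. Qed.

HB.instance Definition _ :=
  Measure_isProbability.Build _ _ _ kernel_law kernel_law_setT.

End kernel_law.

Section local_privacy.
Context (R : realType).

Definition data_space : set R := `[- 2^-1, 2^-1].

(* A channel acting on the data space is represented by a probability kernel
   defined on all of R; its values outside data_space are unconstrained, and
   they are irrelevant for the distributions carried by data_space. *)
Definition channel := R.-pker R ~> R.

Definition locally_private (eps : R) (C : channel) :=
  forall x x' : R, data_space x -> data_space x' ->
  forall W : set R, measurable W -> (C x W <= (expR eps)%:E * C x' W)%E.

(* The i-th user applies its own channel, with independent randomness, and only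
   the outputs of the channels are released. *)
Definition mechanism n := 'I_n -> channel.

Definition locally_private_mechanism n (eps : 'I_n -> R) (M : mechanism n) :=
  forall i, locally_private (eps i) (M i).

Definition sample_law n (P : probability R R) : probability (n.-tuple R) R :=
  product_law (fun=> P).

Definition release_law n (M : mechanism n) (x : n.-tuple R) :
    probability (n.-tuple R) R :=
  product_law (fun i => kernel_law (M i) (tnth x i)).

(* A possibly randomized measurable estimator is a probability kernel. *)
Definition estimator n := R.-pker (n.-tuple R) ~> R.

Definition parameter := probability R R -> R.

Definition mean_squared_error n (theta : parameter) (M : mechanism n)
    (That : estimator n) (P : probability R R) : \bar R :=
  (\int[sample_law n P]_x \int[release_law M x]_y \int[That y]_t
     (`|t - theta P| ^+ 2)%:E)%E.

Definition minimax_error n (Ps : set (probability R R)) (theta : parameter)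
    (eps : 'I_n -> R) : \bar R :=
  ereal_inf [set ereal_sup [set mean_squared_error theta TM.1 TM.2 P | P in Ps]
            | TM in [set TM : mechanism n * estimator n |
                     locally_private_mechanism eps TM.1]].

Definition bounded_distributions : set (probability R R) :=
  [set P | {ae P, forall x : R, `|x| <= 2^-1}].

Definition mean : parameter := fun P => \int[P]_x x.

End local_privacy.

Section laplace_law.
Context (R : realType).
Notation mu := (@lebesgue_measure R).

Definition laplace_pdf (b z : R) : R := (2 * b)^-1 * expR (- (`|z| / b)).

Lemma continuous_laplace_pdf b : continuous (laplace_pdf b).
Proof.
move=> x; apply: (@continuousM _ R^o (fun=> _) (fun z => expR (- (`|z| / b)))).
  exact: cst_continuous.
apply: continuous_comp; last exact: continuous_expR.
apply: (@continuousN _ R^o); apply: (@continuousM _ R^o).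
  exact: norm_continuous.
exact: cst_continuous.
Qed.

Lemma measurable_laplace_pdf b : measurable_fun setT (laplace_pdf b).
Proof.
by apply: continuous_measurable_fun; exact: continuous_laplace_pdf.
Qed.

Section positive_scale.
Variables (b : R) (b_gt0 : 0 < b).

Lemma laplace_pdf_ge0 z : 0 <= laplace_pdf b z.
Proof. by rewrite mulr_ge0 ?expR_ge0// invr_ge0 mulr_ge0// ltW. Qed.

Lemma integral_laplace_pdf : (\int[mu]_z (laplace_pdf b z)%:E = 1)%E.
Proof.
rewrite ge0_symfun_integralT; last 3 first.
- exact: laplace_pdf_ge0.
- exact: continuous_laplace_pdf.
- by move=> z /=; rewrite /laplace_pdf normrN.
have bV0 : 0 < b^-1 by rewrite invr_gt0.
rewrite -ge0_integralZl//=; last 3 first.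
- by rewrite -set_itvcy.
- apply/measurable_EFinP/measurable_funTS; exact: measurable_laplace_pdf.
- by move=> z _; rewrite lee_fin laplace_pdf_ge0.
rewrite -[RHS](integral_exponential_pdf bV0) -set_itvcy.
rewrite integral_mkcond; apply: eq_integral => x _; rewrite patchE.
case: ifPn => [|x0].
  rewrite inE/= in_itv/= andbT => x0.
  rewrite -EFinM exponential_pdfE// /laplace_pdf ger0_norm// invfM !mulrA.
  by rewrite divff ?pnatr_eq0// mul1r mulNr (mulrC x).
rewrite /exponential_pdf patchE ifF//; exact/negbTE.
Qed.

Definition laplace_law of 0 < b : set R -> \bar R :=
  fun W => (\int[mu]_(z in W) (laplace_pdf b z)%:E)%E.

Local Notation law := (laplace_law b_gt0).

Let law0 : law set0 = 0%E.
Proof. exact: integral_set0. Qed.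

Let law_ge0 W : (0 <= law W)%E.
Proof. by apply: integral_ge0 => z _; rewrite lee_fin laplace_pdf_ge0. Qed.

Let law_sigma_additive : semi_sigma_additive law.
Proof.
move=> F mF tF mUF; rewrite /laplace_law; apply: cvg_toP.
  apply: ereal_nondecreasing_is_cvgn => m n mn.
  apply: lee_sum_nneg_natr => // k _ _; apply: integral_ge0 => z _.
  by rewrite lee_fin laplace_pdf_ge0.
rewrite ge0_integral_bigcup//=.
- apply/measurable_funTS/measurable_EFinP; exact: measurable_laplace_pdf.
- by move=> z _; rewrite lee_fin laplace_pdf_ge0.
Qed.

HB.instance Definition _ := isMeasure.Build _ _ _ law
  law0 law_ge0 law_sigma_additive.

Let law_setT : law setT = 1%E.
Proof. exact: integral_laplace_pdf. Qed.

HB.instance Definition _ := Measure_isProbability.Build _ _ _ law law_setT.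

End positive_scale.
End laplace_law.

Section laplace_channel.
Context (R : realType).

Section positive_scale.
Variables (b : R) (b_gt0 : 0 < b).

Let measurable_shift (x : R) : measurable_fun setT (+%R x).
Proof. exact: measurable_funD. Qed.

HB.instance Definition _ (x : R) :=
  isMeasurableFun.Build _ _ _ _ (+%R x) (measurable_shift x).

(* x |-> law of x + Laplace(b) *)
Definition add_laplace (x : R) : {measure set R -> \bar R} :=
  distribution (laplace_law b_gt0) (+%R x).

Let measurable_add_laplace (W : set R) : measurable W ->
  measurable_fun setT (add_laplace ^~ W).
Proof.
move=> mW.
pose A := (fun z : R * R => z.1 + z.2) @^-1` W.
have mA : measurable A.
  by rewrite -[A]setTI; apply: measurable_funD.
rewrite (_ : add_laplace ^~ W = laplace_law b_gt0 \o xsection A).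
  exact: measurable_fun_xsection.
by apply/funext => x /=; rewrite /xsection/=; congr laplace_law;
  apply/seteqP; split => y /=; rewrite inE.
Qed.

HB.instance Definition _ :=
  isKernel.Build _ _ _ _ _ add_laplace measurable_add_laplace.

Let add_laplace_setT x : add_laplace x setT = 1%E.
Proof. exact: probability_setT. Qed.

HB.instance Definition _ :=
  Kernel_isProbability.Build _ _ _ _ _ add_laplace add_laplace_setT.

End positive_scale.

(* The noise has scale 1 / eps; a user with eps = 0 releases nothing, which is
   rendered by the constant output 0. *)
Definition laplace_channel (eps : R) : channel R :=
  match pselect (0 < eps) with
  | left eps_gt0 => add_laplace (etrans (invr_gt0 eps) eps_gt0)
  | right _ => kdirac (@measurable_cst _ _ R R setT 0)
  end.

Definition laplace_mechanism n (eps : 'I_n -> R) : mechanism R n :=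
  fun i => laplace_channel (eps i).

End laplace_channel.

Section linear_estimator.
Context (R : realType) (n : nat).

Definition linear_combination (w : 'I_n -> R) (y : n.-tuple R) : R :=
  \sum_(i < n) w i * tnth y i.

Lemma measurable_linear_combination w :
  measurable_fun setT (linear_combination w).
Proof.
apply: measurable_sum => i; apply: measurable_funM => //.
exact: measurable_tnth.
Qed.

Definition linear_estimator (w : 'I_n -> R) : estimator R n :=
  kdirac (measurable_linear_combination w).

End linear_estimator.

(* Main.v *)
(* Lower bound.  Le Cam's method with the two laws on {-1/2, 1/2} of means
   +-delta/2, where delta^2 = min(1/S, 1) and S is the sum of the eps_i^2.  If
   mu and nu are the laws of one released value under the two hypotheses,
   privacy gives the chi-square type bound
     (int g dmu)^2 <= (1 + delta^2 (e^eps - 1)^2) int g^2 dnu,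
   which is obtained without densities by centring g at its nu-mean and
   estimating its positive and negative parts separately.  In this form the
   bound is multiplicative over users, so with n users the constant is at most
   exp(16 delta^2 S) <= e^16.  Applied to g(y) = That(y)([0, oo[), the
   probability of guessing a nonnegative mean, and combined with Markov's
   inequality, it shows that one of the two errors is at least
   delta^2 / (16 e^16).

   Upper bound.  The Laplace mechanism with weights w_i = eps_i^2 / S is
   unbiased, and its variance is at most the sum of w_i^2 (1 + 16 / eps_i^2),
   hence at most 17 / S. *)
Require Import Defs.
From HB Require Import structures.
From mathcomp Require Import all_boot all_order all_algebra.
From mathcomp Require Import all_classical all_reals all_analysis.
From mathcomp Require Import measurable_realfun ring lra.

Import Order.TTheory GRing.Theory Num.Theory.
Import numFieldNormedType.Exports.

Local Open Scope classical_set_scope.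
Local Open Scope ring_scope.

Set Implicit Arguments.
Unset Strict Implicit.
Unset Printing Implicit Defensive.

(** * Products of probability measures and released values *)

Lemma integral_probability_cst d (T : measurableType d) (R : realType)
    (mu : probability T R) (r : R) : (\int[mu]__ r%:E = r%:E)%E.
Proof. by rewrite integral_cst//= probability_setT mule1. Qed.

Section probability_family.
Context d d' (X : measurableType d) (T : measurableType d') (R : realType).
Variables (mu : X -> probability T R)
  (mmu : forall W, measurable W -> measurable_fun setT (mu ^~ W)).

(* The measurability proof is an argument so that the kernel instances below can
   be found by unification. *)
Definition family_kernel of (forall W, measurable W ->
    measurable_fun setT (mu ^~ W)) : X -> {measure set T -> \bar R} :=
  fun x => mu x.

Local Notation k := (family_kernel mmu).

HB.instance Definition _ := isKernel.Build _ _ _ _ _ k mmu.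

Let k_setT x : k x setT = 1%E. Proof. exact: probability_setT. Qed.

HB.instance Definition _ := Kernel_isProbability.Build _ _ _ _ _ k k_setT.

End probability_family.

Section product_law_theory.
Context d (T : measurableType d) (R : realType).
Local Open Scope ereal_scope.

(** Needed because [release_law M x] is integrated in the sample [x]. By induction, the mass of [A]
    is the integral over the first coordinate [y] of the mass of the [y]-section of [A] under the
    tail law, which is viewed as a kernel in [(x, y)] that ignores [y]. *)
Lemma measurable_product_law d' (X : measurableType d') n
    (mu : X -> 'I_n -> probability T R) :
  (forall i W, measurable W -> measurable_fun setT (fun x => mu x i W)) ->
  forall A, measurable A ->
    measurable_fun setT (fun x => product_law (mu x) A).
Proof.
elim: n => [|n IHn] in mu *; move=> mmu A mA /=; first exact: measurable_cst.
pose mu' x (i : 'I_n) := mu x (lift ord0 i).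
have mmu' i W : measurable W -> measurable_fun setT (fun x => mu' x i W).
  exact: mmu.
pose B : set (T * n.-tuple T) := @tuple_cons _ T n @^-1` A.
have mB : measurable B.
  by rewrite -[B]setTI; apply: measurable_tuple_cons.
pose l := family_kernel (mmu ord0).
have mtail W : measurable W ->
    measurable_fun setT (fun z : X * T => product_law (mu' z.1) W).
  move=> mW; apply: (measurableT_comp (IHn _ mmu' _ mW)); exact: measurable_fst.
pose k := family_kernel mtail.
pose C : set (X * T * n.-tuple T) := [set z | B (z.1.2, z.2)].
have mC : measurable C.
  have mp : measurable_fun setT
      (fun z : X * T * n.-tuple T => (z.1.2, z.2)).
    apply/measurable_fun_pairP; split => //=.
      exact: measurableT_comp measurable_snd measurable_fst.
    exact: measurable_snd.
  by rewrite -[C]setTI; exact: (mp measurableT _ mB).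
have mk : measurable_fun setT (fun z => k z (xsection C z)).
  by apply: measurable_fun_xsection_finite_kernel; rewrite inE.
rewrite [X in measurable_fun _ X](_ : _ =
    fun x => \int[l x]_y k (x, y) (xsection C (x, y))).
  exact: (measurable_fun_integral_finite_kernel
    (fun z => k z (xsection C z)) l).
apply/funext => x; rewrite /pushforward/=.
apply: eq_integral => y _ /=; rewrite /k/= /family_kernel; congr (_ _).
Qed.

Lemma integral_product_law_cons n (mu : 'I_n.+1 -> probability T R)
    (f : n.+1.-tuple T -> \bar R) :
  measurable_fun setT f -> (forall y, 0 <= f y) ->
  \int[product_law mu]_y f y =
  \int[mu ord0]_x \int[product_law (fun i : 'I_n => mu (lift ord0 i))]_y
    f (tuple_cons (x, y)).
Proof.
move=> mf f0 /=.
rewrite ge0_integral_pushforward// preimage_setT fubini_tonelli1//; last first.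
  by move=> z; exact: f0.
by apply: measurableT_comp => //; exact: measurable_tuple_cons.
Qed.

End product_law_theory.

(** * Expectations over the sample and the released values *)

Section released_expectation.
Context (R : realType).
Local Open Scope ereal_scope.

(** When [F] is the conditional squared error given the outputs, this is [mean_squared_error] by
    conversion. *)
Definition released_expectation n (P : probability R R) (M : mechanism R n)
    (F : n.-tuple R -> \bar R) : \bar R :=
  \int[sample_law n P]_x \int[release_law M x]_y F y.

Lemma measurable_release_integral n (M : mechanism R n)
    (F : n.-tuple R -> \bar R) :
  measurable_fun setT F -> (forall y, 0 <= F y) ->
  measurable_fun setT (fun x => \int[release_law M x]_y F y).
Proof.
move=> mF F0; apply: measurable_fun_integral_kernel => // U mU.
apply: measurable_product_law => // i W mW.
apply: (measurableT_comp (measurable_kernel (M i) W mW)).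
exact: measurable_tnth.
Qed.

Definition tail_mechanism n (M : mechanism R n.+1) : mechanism R n :=
  fun i => M (lift ord0 i).

(** Tonelli puts the first user's output innermost, so that it can be averaged out while the other
    outputs are held fixed. *)
Lemma release_integral_cons n (M : mechanism R n.+1) (x : R)
    (x' : n.-tuple R) (F : n.+1.-tuple R -> \bar R) :
  measurable_fun setT F -> (forall y, 0 <= F y) ->
  \int[release_law M (tuple_cons (x, x'))]_y F y =
  \int[release_law (tail_mechanism M) x']_y \int[M ord0 x]_z
    F (tuple_cons (z, y)).
Proof.
move=> mF F0.
have E : (fun i : 'I_n => kernel_law (M (lift ord0 i))
    (tnth (tuple_cons (x, x')) (lift ord0 i)) : probability R R) =
    (fun i => kernel_law (tail_mechanism M i) (tnth x' i)).
  by apply/funext => i; rewrite tnthS.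
have mG : measurable_fun setT (F \o @tuple_cons _ R n).
  by apply: measurableT_comp => //; exact: measurable_tuple_cons.
rewrite /release_law integral_product_law_cons; [|exact: mF|exact: F0].
rewrite E.
exact: (@fubini_tonelli _ _ _ _ _ (kernel_law (M ord0) x : probability R R)
  (release_law (tail_mechanism M) x') _ mG (fun z => F0 (tuple_cons z))).
Qed.

Lemma released_expectation_cons n P (M : mechanism R n.+1)
    (F : n.+1.-tuple R -> \bar R) :
  measurable_fun setT F -> (forall y, 0 <= F y) ->
  released_expectation P M F =
  \int[P]_x released_expectation P (tail_mechanism M)
    (fun y => \int[M ord0 x]_z F (tuple_cons (z, y))).
Proof.
move=> mF F0; rewrite /released_expectation /sample_law.
rewrite integral_product_law_cons; last 2 first.
- exact: measurable_release_integral.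
- by move=> x; exact: integral_ge0.
apply: eq_integral => x _; apply: eq_integral => x' _.
exact: release_integral_cons.
Qed.

(** By [release_integral_cons], the function is a partial integral of a measurable function of the
    whole sample, so Tonelli's theorem applies. *)
Lemma measurable_released_expectation_cons n P (M : mechanism R n.+1)
    (F : n.+1.-tuple R -> \bar R) :
  measurable_fun setT F -> (forall y, 0 <= F y) ->
  measurable_fun setT (fun x => released_expectation P (tail_mechanism M)
    (fun y => \int[M ord0 x]_z F (tuple_cons (z, y)))).
Proof.
move=> mF F0.
pose G (z : R * n.-tuple R) := \int[release_law M (tuple_cons z)]_y F y.
have mG : measurable_fun setT G.
  apply: (measurableT_comp (measurable_release_integral M mF F0)).
  exact: measurable_tuple_cons.
rewrite (_ : (fun x => _) = fubini_F (sample_law n P) G).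
  apply: measurable_fun_fubini_tonelli_F => // z.
  exact: integral_ge0.
apply/funext => x; apply: eq_integral => x' _.
exact/esym/release_integral_cons.
Qed.

Lemma released_expectation_ge0 n P (M : mechanism R n) F :
  (forall y, 0 <= F y) -> 0 <= released_expectation P M F.
Proof. by move=> F0; apply: integral_ge0 => x _; exact: integral_ge0. Qed.

Lemma released_expectation_cst n P (M : mechanism R n) (r : R) :
  released_expectation P M (fun=> r%:E) = r%:E.
Proof.
transitivity (\int[sample_law n P]__ r%:E).
  by apply: eq_integral => x _; exact: integral_probability_cst.
exact: integral_probability_cst.
Qed.

Lemma le_released_expectation n P (M : mechanism R n) F G :
  measurable_fun setT F -> measurable_fun setT G ->
  (forall y, 0 <= F y <= G y) ->
  released_expectation P M F <= released_expectation P M G.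
Proof.
move=> mF mG FG.
have F0 y : 0 <= F y by have /andP[] := FG y.
have F_le_G y : F y <= G y by have /andP[] := FG y.
have G0 y : 0 <= G y by exact: le_trans (F_le_G y).
apply: ge0_le_integral => //.
- by move=> x _; exact: integral_ge0.
- exact: measurable_release_integral.
- exact: measurable_release_integral.
- by move=> x _; apply: ge0_le_integral.
Qed.

Lemma released_expectationD n P (M : mechanism R n) F G :
  measurable_fun setT F -> measurable_fun setT G ->
  (forall y, 0 <= F y) -> (forall y, 0 <= G y) ->
  released_expectation P M (fun y => F y + G y) =
  released_expectation P M F + released_expectation P M G.
Proof.
move=> mF mG F0 G0; rewrite /released_expectation -ge0_integralD//.
- by apply: eq_integral => x _; rewrite ge0_integralD.
- by move=> x _; exact: integral_ge0.
- exact: measurable_release_integral.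
- by move=> x _; exact: integral_ge0.
- exact: measurable_release_integral.
Qed.

Lemma released_expectationZl n P (M : mechanism R n) (r : R) F :
  (0 <= r)%R -> measurable_fun setT F -> (forall y, 0 <= F y) ->
  released_expectation P M (fun y => r%:E * F y) =
  r%:E * released_expectation P M F.
Proof.
move=> r0 mF F0; rewrite /released_expectation -ge0_integralZl//.
- by apply: eq_integral => x _; rewrite ge0_integralZl.
- exact: measurable_release_integral.
- by move=> x _; exact: integral_ge0.
Qed.

End released_expectation.

(** * Lower bound *)

Section bounded_measurable.
Context d (T : measurableType d) (R : realType).
Implicit Types (f g : T -> R) (mu : probability T R) (r : R).

(** A class stable under sums, products and absolute values, and integrable for every probability:
    on it [Rintegral] is linear with no further side condition. *)
Definition bounded_measurable f :=
  measurable_fun setT f /\ exists r, forall x, `|f x| <= r.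

Lemma bounded_measurable_cst r : bounded_measurable (fun=> r).
Proof. by split; [exact: measurable_cst|exists `|r|]. Qed.

Lemma bounded_measurableD f g : bounded_measurable f -> bounded_measurable g ->
  bounded_measurable (fun x => f x + g x).
Proof.
move=> [mf [r fr]] [mg [s gs]]; split; first exact: measurable_funD.
by exists (r + s) => x; rewrite (le_trans (ler_normD _ _))// lerD.
Qed.

Lemma bounded_measurableM f g : bounded_measurable f -> bounded_measurable g ->
  bounded_measurable (fun x => f x * g x).
Proof.
move=> [mf [r fr]] [mg [s gs]]; split; first exact: measurable_funM.
by exists (r * s) => x; rewrite normrM ler_pM.
Qed.

Lemma bounded_measurable_norm f : bounded_measurable f ->
  bounded_measurable (fun x => `|f x|).
Proof.
move=> [mf [r fr]]; split; first exact: measurableT_comp.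
by exists r => x; rewrite normr_id.
Qed.

Lemma bounded_measurable_integrable mu f :
  bounded_measurable f -> mu.-integrable setT (EFin \o f).
Proof.
move=> [mf [r fr]].
apply: (@le_integrable _ _ _ mu setT measurableT _ (fun=> r%:E)).
- exact/measurable_EFinP.
- by move=> x _ /=; rewrite lee_fin (le_trans (fr x))// ler_norm.
- by apply: finite_measure_integrable_cst.
Qed.

Lemma Rintegral_probability_cst mu r : \int[mu]__ r = r.
Proof. by rewrite /Rintegral integral_probability_cst. Qed.

Lemma bounded_RintegralD mu f g :
  bounded_measurable f -> bounded_measurable g ->
  \int[mu]_x (f x + g x) = \int[mu]_x f x + \int[mu]_x g x.
Proof.
by move=> bf bg; apply: RintegralD => //; exact: bounded_measurable_integrable.
Qed.

Lemma bounded_RintegralZl mu r f : bounded_measurable f ->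
  \int[mu]_x (r * f x) = r * \int[mu]_x f x.
Proof.
by move=> bf; apply: RintegralZl => //; exact: bounded_measurable_integrable.
Qed.

Lemma bounded_EFin_Rintegral mu f : bounded_measurable f ->
  (\int[mu]_x f x)%:E = (\int[mu]_x (f x)%:E)%E.
Proof.
move=> bf; rewrite /Rintegral fineK//; apply: integrable_fin_num => //.
exact: bounded_measurable_integrable.
Qed.

End bounded_measurable.

(** * Two laws that dominate each other up to a factor *)

Section private_pair.
Context d (T : measurableType d) (R : realType).
Variables (a b : probability T R) (E : R).
Hypotheses (E_ge1 : 1 <= E).
Hypothesis ab : forall W, measurable W -> (a W <= E%:E * b W)%E.
Hypothesis ba : forall W, measurable W -> (b W <= E%:E * a W)%E.

(** The integral is monotone in the measure; here [mu] is compared with [nu] scaled by [E]. *)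
Lemma dominated_Rintegral (mu nu : probability T R) (u : T -> R) :
  (forall W, measurable W -> (mu W <= E%:E * nu W)%E) ->
  bounded_measurable u -> (forall x, 0 <= u x) ->
  \int[mu]_x u x <= E * \int[nu]_x u x.
Proof.
move=> munu bu u0; have E0 : 0 <= E by exact: le_trans E_ge1.
rewrite -lee_fin EFinM !bounded_EFin_Rintegral//.
have mu' : measurable_fun setT (EFin \o u) by apply/measurable_EFinP; case: bu.
have := @ge0_le_measure_integral _ _ _ mu (mscale (NngNum E0) nu) munu
  (EFin \o u) setT measurableT.
rewrite ge0_integral_mscale//; first by apply.
by move=> x _; rewrite lee_fin.
Qed.

(** [a] and [b] will be the laws of one output on the inputs 1/2 and -1/2. For
    [q = (1 - delta) / 2], [N u] is then the mean of [u] under the hypothesis of mean -delta/2, and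
    exchanging [q] and [1 - q] gives the other hypothesis. *)
Variables (q : R) (q01 : 0 <= q <= 1).
Local Notation N u := (q * \int[a]_x u x + (1 - q) * \int[b]_x u x).

Let N_ge0 u : (forall x, 0 <= u x) -> 0 <= N u.
Proof.
move=> u0; case/andP: q01 => q0 q1.
by rewrite addr_ge0// mulr_ge0 ?Rintegral_ge0// subr_ge0.
Qed.

(** By domination, the difference is at most [E - 1] times the smaller of the two integrals, which
    lies below any convex combination of them. *)
Lemma private_pair_ge0_diff (u : T -> R) : bounded_measurable u ->
  (forall x, 0 <= u x) ->
  `|\int[a]_x u x - \int[b]_x u x| <= (E - 1) * N u.
Proof.
move=> bu u0; case/andP: q01 => q0 q1.
have := dominated_Rintegral ab bu u0; have := dominated_Rintegral ba bu u0.
have : 0 <= \int[a]_x u x by exact: Rintegral_ge0.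
have : 0 <= \int[b]_x u x by exact: Rintegral_ge0.
have E10 : 0 <= E - 1 by rewrite subr_ge0.
move: (\int[a]_x u x) (\int[b]_x u x) => x y y0 x0 yx xy.
have [xley|yltx] := leP x y.
  have xN : x <= q * x + (1 - q) * y by nra.
  by have := ler_wpM2l E10 xN; rewrite ler0_norm ?subr_le0//; lra.
have yN : y <= q * x + (1 - q) * y by nra.
by have := ler_wpM2l E10 yN; rewrite gtr0_norm ?subr_gt0//; lra.
Qed.

(** The nonnegative case is applied to [|h| + h] and [|h| - h], twice the positive and negative
    parts of [h]; their [N]-integrals add up to twice that of [|h|]. *)
Lemma private_pair_diff (h : T -> R) : bounded_measurable h ->
  `|\int[a]_x h x - \int[b]_x h x| <= (E - 1) * N (fun x => `|h x|).
Proof.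
move=> bh; have bnh := bounded_measurable_norm bh.
have bNh := bounded_measurableM (bounded_measurable_cst T (-1)) bh.
have U0 x : 0 <= `|h x| + h x.
  by have := ler_norm (- h x); rewrite normrN; lra.
have L0 x : 0 <= `|h x| + -1 * h x by have := ler_norm (h x); lra.
have := private_pair_ge0_diff (bounded_measurableD bnh bh) U0.
have := private_pair_ge0_diff (bounded_measurableD bnh bNh) L0.
rewrite !bounded_RintegralD// !bounded_RintegralZl// !ler_norml.
by move=> /andP[? ?] /andP[? ?]; apply/andP; split; lra.
Qed.

(** Nonnegativity of the variance: with [t = N |h|], expand [0 <= N ((|h| - t)^2)]. *)
Lemma mixture_sqr_norm (h : T -> R) : bounded_measurable h ->
  (N (fun x => `|h x|)) ^+ 2 <= N (fun x => h x * h x).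
Proof.
move=> bh; have bnh := bounded_measurable_norm bh.
have bhh := bounded_measurableM bh bh.
set t := N (fun x => `|h x|).
have : 0 <= N (fun x => h x * h x + ((- 2 * t) * `|h x| + t ^+ 2)).
  apply: N_ge0 => x; rewrite -expr2 -real_normK ?num_real//.
  by have := sqr_ge0 (`|h x| - t); nra.
have bc := @bounded_measurable_cst _ T R.
have bt := bounded_measurableM (bc (- 2 * t)) bnh.
have btc := bounded_measurableD bt (bc (t ^+ 2)).
rewrite !(bounded_RintegralD _ bhh btc) !(bounded_RintegralD _ bt (bc _)).
rewrite !(bounded_RintegralZl _ _ bnh) !Rintegral_probability_cst.
by rewrite /t; lra.
Qed.

(** The left-hand mixture of integrals is [m + delta D], with [m = N g] and [D] the difference of
    the integrals of [g] under [a] and [b]. As [D] is unchanged when [g] is centred at [m], it is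
    controlled by the variance [N (g^2) - m^2] rather than by the second moment. *)
Lemma private_mixture_second_moment (delta : R) (g : T -> R) :
  q = (1 - delta) / 2 -> bounded_measurable g ->
  ((1 - q) * \int[a]_x g x + q * \int[b]_x g x) ^+ 2 <=
  (1 + delta ^+ 2 * (E - 1) ^+ 2) * N (fun x => g x * g x).
Proof.
move=> qd bg; set m := N g.
have bc := @bounded_measurable_cst _ T R.
have bh := bounded_measurableD bg (bc (- m)).
have := mixture_sqr_norm bh.
have := private_pair_diff bh.
have N0 : 0 <= N (fun x => `|g x - m|) by exact: N_ge0.
have -> : N (fun x => (g x - m) * (g x - m)) =
    N (fun x => g x * g x) - m ^+ 2.
  rewrite (_ : (fun x => (g x - m) * (g x - m)) =
      fun x => g x * g x + ((- 2 * m) * g x + m ^+ 2)); last first.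
    by apply/funext => x; ring.
  have bgg := bounded_measurableM bg bg.
  have bt := bounded_measurableM (bc (- 2 * m)) bg.
  have btc := bounded_measurableD bt (bc (m ^+ 2)).
  rewrite !(bounded_RintegralD _ bgg btc) !(bounded_RintegralD _ bt (bc _)).
  rewrite !(bounded_RintegralZl _ _ bg) !Rintegral_probability_cst.
  by rewrite /m; ring.
rewrite !(bounded_RintegralD _ bg (bc _)) !Rintegral_probability_cst.
have -> : (1 - q) * \int[a]_x g x + q * \int[b]_x g x =
    m + delta * (\int[a]_x g x - \int[b]_x g x).
  by rewrite /m qd; field.
move: (N (fun x => g x * g x)) (N (fun x => `|g x - m|)) N0 => S r r0.
move=> Dr rV.
set D := \int[a]_x g x - \int[b]_x g x.
have {}Dr : `|D| <= (E - 1) * r.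
  apply: le_trans Dr; rewrite le_eqVlt; apply/orP; left; apply/eqP.
  by congr `|_|; rewrite /D; ring.
have DD : D ^+ 2 <= (E - 1) ^+ 2 * (S - m ^+ 2).
  rewrite -real_normK ?num_real//.
  apply: (@le_trans _ _ (((E - 1) * r) ^+ 2)).
    by rewrite lerXn2r// nnegrE ?(le_trans _ Dr).
  by rewrite exprMn ler_wpM2l ?sqr_ge0.
(* [2 m delta D <= (S - m^2) + (m delta (E - 1))^2], by AM-GM *)
set X := S - m ^+ 2 in rV DD; set Y := (m * delta * (E - 1)) ^+ 2.
have X0 : 0 <= X by apply: le_trans rV; exact: sqr_ge0.
have Y0 : 0 <= Y by exact: sqr_ge0.
have mDXY : (m * delta * D) ^+ 2 <= X * Y.
  by have := ler_wpM2l (sqr_ge0 (m * delta)) DD; rewrite /Y; lra.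
have amgm : 2 * (m * delta * D) <= X + Y.
  rewrite leNgt; apply/negP => lt.
  have XY0 : 0 <= X + Y by exact: addr_ge0.
  have : (X + Y) ^+ 2 < (2 * (m * delta * D)) ^+ 2.
    by rewrite ltrXn2r// ltNge (le_trans XY0 (ltW lt)).
  by have := sqr_ge0 (X - Y); lra.
(* With [S = X + m^2], the bounds on [2 m delta D] and on [delta^2 D^2] add up to exactly the stated
   constant times [S]. *)
have := ler_wpM2l (sqr_ge0 delta) DD.
have -> : S = X + m ^+ 2 by rewrite /X subrK.
by move: amgm; rewrite /Y; lra.
Qed.
End private_pair.

(** * Two-point laws and means of bounded laws *)

Section two_point_law.
Context (R : realType).

Definition signed_half (s : bool) : R := if s then 2^-1 else - 2^-1.

Let measurable_signed_half : measurable_fun setT signed_half.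
Proof. by []. Qed.

HB.instance Definition _ :=
  isMeasurableFun.Build _ _ _ _ signed_half measurable_signed_half.

Definition two_point_law (p : R) : probability R R :=
  distribution (bernoulli_prob p) signed_half.

Lemma bounded_two_point_law p : bounded_distributions (two_point_law p).
Proof.
exists (~` [set x | `|x| <= 2^-1]); split.
- apply: measurableC; rewrite -[X in measurable X]setTI.
  exact: measurable_fun_le.
- have E : signed_half @^-1` (~` [set x | `|x| <= 2^-1]) = set0.
    apply/seteqP; split => // s /=.
    by case: s => /=; rewrite ?normrN ger0_norm// invr_ge0.
  transitivity (bernoulli_prob p (signed_half @^-1`
    (~` [set x | `|x| <= 2^-1]))) => //.
  by rewrite E measure0.
- by [].
Qed.

Lemma integral_two_point_law p (f : R -> \bar R) : 0 <= p <= 1 ->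
  measurable_fun setT f -> (forall x, 0 <= f x)%E ->
  (\int[two_point_law p]_x f x =
   p%:E * f 2^-1%R + (1 - p)%:E * f (- 2^-1)%R)%E.
Proof.
move=> p01 mf f0.
rewrite ge0_integral_pushforward// preimage_setT.
by rewrite integral_bernoulli_prob// => s; exact: f0.
Qed.

End two_point_law.

Section bounded_mean.
Context (R : realType) (P : probability R R).
Hypothesis P_bounded : bounded_distributions P.

(** Laws in [bounded_distributions] are bounded only almost everywhere. Replacing [x] by [clamp x]
    does not change their integrals and makes the variable bounded everywhere, so that the calculus
    of [bounded_measurable] applies. *)
Definition clamp (x : R) : R := Num.max (- 2^-1) (Num.min x 2^-1).

Lemma clamp_id x : `|x| <= 2^-1 -> clamp x = x.
Proof.
rewrite ler_norml => /andP[x1 x2].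
by rewrite /clamp (min_idPl x2); apply/max_idPr.
Qed.

Lemma clamp_bounds x : - 2^-1 <= clamp x <= 2^-1.
Proof.
rewrite /clamp le_max lexx/= ge_max ge_min lexx orbT andbT.
by rewrite (@le_trans _ _ 0)// ?oppr_le0 invr_ge0.
Qed.

Lemma bounded_measurable_clamp : bounded_measurable clamp.
Proof.
split; last by exists 2^-1 => x; rewrite ler_norml clamp_bounds.
by apply: measurable_maxr => //; exact: measurable_minr.
Qed.

Lemma integral_clamp (f : R -> \bar R) : measurable_fun setT f ->
  (\int[P]_x f x = \int[P]_x f (clamp x))%E.
Proof.
move=> mf; apply: ae_eq_integral => //.
  by apply: measurableT_comp => //; case: bounded_measurable_clamp.
apply: filterS P_bounded => x xb _; by rewrite clamp_id.
Qed.

Lemma mean_clamp : mean P = \int[P]_x clamp x.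
Proof.
by rewrite /mean /Rintegral (integral_clamp (f := EFin))//.
Qed.

End bounded_mean.

Lemma mean_two_point_law (R : realType) (p : R) : 0 <= p <= 1 ->
  mean (two_point_law p) = p - 2^-1.
Proof.
move=> p01.
have bc := bounded_measurable_clamp R.
have b2 := bounded_measurable_cst R (2^-1 : R).
have := bounded_RintegralD (two_point_law p) bc b2.
rewrite -(mean_clamp (bounded_two_point_law p)) Rintegral_probability_cst.
(* The shift by 1/2 makes the integrand nonnegative, as [integral_two_point_law] requires; it takes
   the values 1 and 0 at the two atoms. *)
suff -> : \int[two_point_law p]_x (clamp x + 2^-1) = p.
  by move=> pE; lra.
rewrite /Rintegral integral_two_point_law//.
- rewrite !clamp_id ?normrN ?ger0_norm ?invr_ge0// addNr mule0 adde0 -EFinM/=.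
  by lra.
- by apply/measurable_EFinP; case: (bounded_measurableD bc b2).
- by move=> x; rewrite lee_fin; have := clamp_bounds x; lra.
Qed.

(** Put [y = exp(-e/2)], so that [y >= 1 - e/2] and [exp(e) y^2 = 1]. It then suffices that
    [(1 + 4e)(1 - e/2)^2 >= 1]. *)
Lemma expR_sub1_le (R : realType) (e : R) : 0 <= e <= 1 -> expR e - 1 <= 4 * e.
Proof.
move=> /andP[e0 e1].
have hy := expR_ge1Dx (- (e / 2)).
have yy : expR e * expR (- (e / 2)) ^+ 2 = 1.
  by rewrite expr2 -!expRD -opprD -splitr subrr expR0.
move: hy yy (expR_gt0 e) (expR_gt0 (- (e / 2))).
move: (expR e) (expR _) => E y hy Ey E0 y0.
have y2 : (1 - e / 2) ^+ 2 <= y ^+ 2 by rewrite lerXn2r// nnegrE; lra.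
have : 1 <= (1 + 4 * e) * (1 - e / 2) ^+ 2.
  (* This polynomial is [3 - 15e/4 + e^2], and [(1 + 4e)(1 - e/2)^2 - 1] is [e] times it. *)
  have p0 : 0 <= (1 - e) * (11 / 4 - e) + 1 / 4 by nra.
  by have := mulr_ge0 e0 p0; lra.
have : (1 + 4 * e) * (1 - e / 2) ^+ 2 <= (1 + 4 * e) * y ^+ 2.
  by rewrite ler_wpM2l//; lra.
move=> h1 h2.
have : E * y ^+ 2 <= (1 + 4 * e) * y ^+ 2 by rewrite Ey; lra.
by rewrite ler_pM2r ?exprn_gt0//; lra.
Qed.

(** * Comparison of the two hypotheses, user by user *)

Section two_point_release.
Context (R : realType).
Local Open Scope ereal_scope.

(** The conditional expectation of [F] given the outputs [y] of the other users, when the first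
    datum follows [two_point_law p]. *)
Definition first_user_average n (p : R) (M : mechanism R n.+1)
    (F : n.+1.-tuple R -> \bar R) (y : n.-tuple R) : \bar R :=
  p%:E * \int[M ord0 2^-1%R]_z F (tuple_cons (z, y)) +
  (1 - p)%:E * \int[M ord0 (- 2^-1)%R]_z F (tuple_cons (z, y)).

Lemma measurable_first_user_integral n (M : mechanism R n.+1) (x : R)
    (F : n.+1.-tuple R -> \bar R) :
  measurable_fun setT F -> (forall y, 0 <= F y) ->
  measurable_fun setT (fun y => \int[M ord0 x]_z F (tuple_cons (z, y))).
Proof.
move=> mF F0.
have mG : measurable_fun setT (F \o @tuple_cons _ R n).
  by apply: measurableT_comp => //; exact: measurable_tuple_cons.
exact: (@measurable_fun_fubini_tonelli_G _ _ _ _ _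
  (kernel_law (M ord0) x : probability R R) _ mG
  (fun z => F0 (tuple_cons z))).
Qed.

Lemma measurable_first_user_average n p (M : mechanism R n.+1) F :
  measurable_fun setT F -> (forall y, 0 <= F y) ->
  measurable_fun setT (first_user_average p M F).
Proof.
move=> mF F0; apply: emeasurable_funD; apply: measurable_funeM;
  exact: measurable_first_user_integral.
Qed.

Lemma first_user_average_ge0 n p (M : mechanism R n.+1) F y :
  (0 <= p <= 1)%R -> (forall y, 0 <= F y) -> 0 <= first_user_average p M F y.
Proof.
move=> /andP[p0 p1] F0; rewrite adde_ge0// mule_ge0 ?lee_fin ?subr_ge0//;
  exact: integral_ge0.
Qed.

Lemma released_expectation_two_point n p (M : mechanism R n.+1) F :
  (0 <= p <= 1)%R -> measurable_fun setT F -> (forall y, 0 <= F y) ->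
  released_expectation (two_point_law p) M F =
  released_expectation (two_point_law p) (tail_mechanism M)
    (first_user_average p M F).
Proof.
move=> p01 mF F0; have /andP[p0 p1] := p01.
pose I x y := \int[M ord0 x]_z F (tuple_cons (z, y)).
have mI x : measurable_fun setT (I x) by exact: measurable_first_user_integral.
have I0 x y : 0 <= I x y by exact: integral_ge0.
have q0 : (0 <= 1 - p)%R by rewrite subr_ge0.
have mZ r x : measurable_fun setT (fun y => r%:E * I x y).
  exact: measurable_funeM.
have Z0 r x y : (0 <= r)%R -> 0 <= r%:E * I x y by move=> r0; rewrite mule_ge0.
rewrite released_expectation_cons// integral_two_point_law//; first last.
- by move=> x; apply: released_expectation_ge0 => y; exact: I0.
- exact: measurable_released_expectation_cons.
transitivity (released_expectation (two_point_law p) (tail_mechanism M)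
    (fun y => p%:E * I 2^-1%R y) +
  released_expectation (two_point_law p) (tail_mechanism M)
    (fun y => (1 - p)%:E * I (- 2^-1)%R y)).
  by rewrite !released_expectationZl.
rewrite -released_expectationD//.
  by move=> y; exact: Z0.
by move=> y; exact: Z0.
Qed.

End two_point_release.

Section likelihood_ratio.
Context (R : realType).

Lemma tail_mechanism_private n (eps : 'I_n.+1 -> R) (M : mechanism R n.+1) :
  locally_private_mechanism eps M ->
  locally_private_mechanism (fun i : 'I_n => eps (lift ord0 i))
    (tail_mechanism M).
Proof. by move=> Mp i; exact: Mp. Qed.

Lemma data_space_half : data_space (2^-1 : R) /\ data_space (- 2^-1 : R).
Proof.
have h0 : (0 : R) <= 2^-1 by rewrite invr_ge0.
rewrite /data_space/= !in_itv/= !lexx andbT.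
by split; rewrite ?(le_trans _ h0)// ?oppr_le0.
Qed.

(** Induction on the users. The first one is averaged out of [g], giving [G], to which the induction
    hypothesis applies because [G] still takes values in [0, 1]. Then
    [private_mixture_second_moment], used pointwise in the other outputs, replaces [G^2] by the
    average of [g^2]. *)
Lemma released_second_moment n (eps : 'I_n -> R) (M : mechanism R n)
    (delta : R) (g : n.-tuple R -> R) :
  (forall i, 0 <= eps i <= 1) -> locally_private_mechanism eps M ->
  0 <= delta <= 1 -> measurable_fun setT g -> (forall y, 0 <= g y <= 1) ->
  ((released_expectation (two_point_law ((1 + delta) / 2)) M (EFin \o g)) ^+ 2
   <= (expR (16 * delta ^+ 2 * \sum_(i < n) eps i ^+ 2))%:E *
      released_expectation (two_point_law ((1 - delta) / 2)) M
        (fun y => (g y * g y)%:E))%E.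
Proof.
move=> eps01 Mp delta01; have /andP[d0 d1] := delta01.
elim: n => [|n IHn] in eps eps01 M Mp g *; move=> mg g01.
  have gE y : g y = g [tuple] by rewrite tuple0.
  rewrite (_ : EFin \o g = fun=> (g [tuple])%:E); last first.
    by apply/funext => y/=; rewrite gE.
  rewrite (_ : (fun y => (g y * g y)%:E) = fun=> (g [tuple] * g [tuple])%:E).
    rewrite !released_expectation_cst big_ord0 mulr0 expR0 mul1e.
    by rewrite expe2 -EFinM.
  by apply/funext => y/=; rewrite gE.
have [q qE] : exists q, q = (1 - delta) / 2 by eexists.
have q01 : 0 <= q <= 1 by lra.
have Eq : (1 + delta) / 2 = 1 - q by lra.
have p01 : 0 <= 1 - q <= 1 by lra.
have g0 y : (0 <= (EFin \o g) y)%E by rewrite lee_fin; case/andP: (g01 y).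
have mEg : measurable_fun setT (EFin \o g) by exact/measurable_EFinP.
have gg0 y : (0 <= (g y * g y)%:E)%E.
  by rewrite lee_fin mulr_ge0//; case/andP: (g01 y).
have mgg : measurable_fun setT (fun y => (g y * g y)%:E).
  by apply/measurable_EFinP; exact: measurable_funM.
rewrite -qE Eq !released_expectation_two_point//.
pose a := kernel_law (M ord0) 2^-1 : probability R R.
pose b := kernel_law (M ord0) (- 2^-1) : probability R R.
have bg y : bounded_measurable (fun z : R => g (tuple_cons (z, y))).
  split.
    apply: (measurableT_comp mg).
    apply: (measurableT_comp (@measurable_tuple_cons _ R n)).
    exact: measurable_pair2.
  exists 1 => z; have /andP[? ?] := g01 (tuple_cons (z, y)).
  by rewrite ger0_norm.
pose G y := (1 - q) * (\int[a]_z g (tuple_cons (z, y))) +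
  q * \int[b]_z g (tuple_cons (z, y)).
have GE : first_user_average (1 - q) M (EFin \o g) = EFin \o G.
  apply/funext => y; rewrite /first_user_average/= /G.
  by rewrite subKr [RHS]EFinD !EFinM !bounded_EFin_Rintegral.
have mG : measurable_fun setT G.
  by apply/measurable_EFinP; rewrite -GE; exact: measurable_first_user_average.
have G01 y : 0 <= G y <= 1.
  have [qa qb] := andP q01; have [pa pb] := andP p01.
  have I0 (mu : probability R R) : 0 <= \int[mu]_z g (tuple_cons (z, y)).
    by apply: Rintegral_ge0 => z _; case/andP: (g01 (tuple_cons (z, y))).
  have I1 (mu : probability R R) : \int[mu]_z g (tuple_cons (z, y)) <= 1.
    rewrite -[leRHS](Rintegral_probability_cst mu).
    apply: le_Rintegral => //; try exact: bounded_measurable_integrable.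
      apply: bounded_measurable_integrable; exact: bounded_measurable_cst.
    by move=> z _; case/andP: (g01 (tuple_cons (z, y))).
  rewrite addr_ge0 ?mulr_ge0 ?I0//=.
  have := ler_wpM2l pa (I1 a); have := ler_wpM2l qa (I1 b); rewrite /G; lra.
have eps01' i : 0 <= eps (lift ord0 i) <= 1 by exact: eps01.
(* It remains to pass from [G^2] to [g^2] under the law of mean -delta/2; the factor [c] is what the
   first user contributes. *)
have := IHn _ eps01' _ (tail_mechanism_private Mp) _ mG G01.
rewrite -qE Eq -GE => /le_trans; apply.
set c := 1 + delta ^+ 2 * (expR (eps ord0) - 1) ^+ 2.
have c0 : 0 <= c by rewrite addr_ge0// mulr_ge0// sqr_ge0.
(* The 16 is the square of the 4 in [expR_sub1_le]. *)
have le_c : c <= expR (16 * delta ^+ 2 * eps ord0 ^+ 2).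
  apply: le_trans (expR_ge1Dx _); rewrite lerD2l.
  have [e0 e1] := andP (eps01 ord0).
  have eta0 : 0 <= expR (eps ord0) - 1.
    by rewrite subr_ge0 -[leLHS]expR0 ler_expR.
  have eta4 := expR_sub1_le (eps01 ord0).
  have sqr_eta : (expR (eps ord0) - 1) ^+ 2 <= (4 * eps ord0) ^+ 2.
    by rewrite lerXn2r// nnegrE mulr_ge0.
  by have := ler_wpM2l (sqr_ge0 delta) sqr_eta; lra.
set E := released_expectation _ _ _; set F := released_expectation _ _ _.
have EF : (E <= c%:E * F)%E.
  rewrite /F -released_expectationZl//; last 2 first.
  - exact: measurable_first_user_average.
  - by move=> y; exact: first_user_average_ge0.
  apply: le_released_expectation.
  - by apply/measurable_EFinP; exact: measurable_funM.
  - by apply: measurable_funeM; exact: measurable_first_user_average.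
  - move=> y; rewrite lee_fin mulr_ge0/=; [|by case/andP: (G01 y)..].
    have Eexp : 1 <= expR (eps ord0).
      by rewrite -[leLHS]expR0 ler_expR; case/andP: (eps01 ord0).
    have [h1 h2] := data_space_half.
    have := private_mixture_second_moment (a := a) (b := b) Eexp
      (Mp ord0 _ _ h1 h2)
      (Mp ord0 _ _ h2 h1) q01 qE (bg y).
    have bgg := bounded_measurableM (bg y) (bg y).
    rewrite -lee_fin; congr (_ <= _)%E; rewrite EFinM; congr (_ * _)%E.
    by rewrite EFinD !EFinM !bounded_EFin_Rintegral.
have F0 : (0 <= F)%E.
  by apply: released_expectation_ge0 => y; exact: first_user_average_ge0.
rewrite big_ord_recl mulrDr expRD (mulrC (expR _)) EFinM -muleA.
apply: (@le_trans _ _ ((expR (16 * delta ^+ 2 *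
  \sum_(i < n) eps (lift ord0 i) ^+ 2))%:E * (c%:E * F)))%E.
  by rewrite lee_wpmul2l// lee_fin expR_ge0.
rewrite lee_wpmul2l ?lee_fin ?expR_ge0//.
by rewrite lee_wpmul2r.
Qed.

End likelihood_ratio.

(** * From estimation to testing the sign of the mean *)

Section lower_bound.
Context (R : realType).

Lemma markov_squared_error (Q : {measure set R -> \bar R}) (A : set R)
    (c theta : R) :
  measurable A -> 0 <= c -> (forall t, A t -> c <= `|t - theta| ^+ 2) ->
  (c%:E * Q A <= \int[Q]_t (`|t - theta| ^+ 2)%:E)%E.
Proof.
move=> mA c0 cA.
have mI : measurable_fun setT (fun t => (\1_A t)%:E : \bar R).
  by apply/measurable_EFinP; exact: measurable_indic.
rewrite -[A in leLHS]setIT -integral_indic// -ge0_integralZl//.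
apply: ge0_le_integral => //.
- by move=> t _; rewrite lee_fin mulr_ge0.
- exact: measurable_funeM.
- apply/measurable_EFinP; apply: measurable_funX.
  by apply: measurableT_comp => //; exact: measurable_funB.
move=> t _; rewrite -EFinM lee_fin indicE.
by have [/set_mem/cA|_] := boolP (t \in A); rewrite ?mulr1// mulr0 sqr_ge0.
Qed.

Lemma measurable_conditional_squared_error n (That : estimator R n)
    (theta : R) :
  measurable_fun setT (fun y => (\int[That y]_t (`|t - theta| ^+ 2)%:E)%E).
Proof.
apply: measurable_fun_integral_kernel => //.
- by move=> W mW; exact: measurable_kernel.
- apply/measurable_EFinP; apply: measurable_funX.
  by apply: measurableT_comp => //; exact: measurable_funB.
Qed.

(** The mean is delta/2 for [s = false] and -delta/2 for [s = true]. A guess of the wrong sign costs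
    at least [delta^2 / 4], and [released_second_moment] prevents the test from being nearly always
    right under both hypotheses. *)
Lemma two_point_squared_error n (eps : 'I_n -> R) (M : mechanism R n)
    (That : estimator R n) (delta : R) (r : R) :
  (forall i, 0 <= eps i <= 1) -> locally_private_mechanism eps M ->
  0 <= delta <= 1 -> delta ^+ 2 * \sum_(i < n) eps i ^+ 2 <= 1 ->
  (forall s : bool, mean_squared_error (@mean R) M That
    (two_point_law ((1 + (-1) ^+ s * delta) / 2)) <= r%:E)%E ->
  delta ^+ 2 / (16 * expR 16) <= r.
Proof.
move=> eps01 Mp d01 dS mse; have [d0 d1] := andP d01.
pose A := [set t : R | 0 <= t].
have mA : measurable A by rewrite /A -set_itvcy.
have That_fin y B : measurable B -> That y B \is a fin_num.
  exact: (fin_num_measure (kernel_law That y : probability R R)).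
have ThatT y : That y setT = 1%E.
  exact: (probability_setT (kernel_law That y : probability R R)).
have ThatA y : That y A = (fine (That y A))%:E by rewrite fineK// That_fin.
pose g y := fine (That y A).
have ThatAC y : That y (~` A) = (1 - g y)%:E.
  have H : (1 = That y A + That y (~` A))%E.
    rewrite -(ThatT y) -(setUCr A).
    exact: (measureU (kernel_law That y : probability R R)
      mA (measurableC mA) (setICr A)).
  by rewrite EFinB H -ThatA addeAC subee ?add0e// That_fin.
have g01 y : 0 <= g y <= 1.
  rewrite fine_ge0//= -lee_fin -ThatA.
  exact: (probability_le1 (kernel_law That y : probability R R)).
have mg : measurable_fun setT g.
  apply/measurable_EFinP; rewrite (_ : _ \o _ = That ^~ A).
    exact: measurable_kernel.
  by apply/funext => y /=; rewrite ThatA.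
have mCg : measurable_fun setT (fun y => (1 - g y)%:E).
  by apply/measurable_EFinP; exact: measurable_funB.
pose p (s : bool) : R := (1 + (-1) ^+ s * delta) / 2.
have p01 (s : bool) : 0 <= p s <= 1.
  by rewrite /p; case: s; rewrite ?expr0 ?expr1; lra.
have EgN s : released_expectation (two_point_law (p s)) M (EFin \o g)
    \is a fin_num.
  rewrite ge0_fin_numE; last first.
    apply: released_expectation_ge0 => y.
    by rewrite lee_fin; case/andP: (g01 y).
  apply: (@le_lt_trans _ _ 1%:E); last exact: ltry.
  rewrite -(released_expectation_cst (two_point_law (p s)) M 1).
  apply: le_released_expectation; last by move=> y; rewrite !lee_fin.
    exact/measurable_EFinP.
  exact: measurable_cst.
pose x s := fine (released_expectation (two_point_law (p s)) M (EFin \o g)).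
have xE s : released_expectation (two_point_law (p s)) M (EFin \o g) = (x s)%:E.
  by rewrite fineK.
have xCE s : released_expectation (two_point_law (p s)) M
    (fun y => (1 - g y)%:E) = (1 - x s)%:E.
  have := @released_expectationD _ _ (two_point_law (p s)) M
    (EFin \o g) (fun y => (1 - g y)%:E).
  rewrite (_ : (fun y => _ + _)%E = fun=> 1%:E); last first.
    by apply/funext => y; rewrite -EFinD subrKC.
  rewrite released_expectation_cst xE => H.
  rewrite EFinB H; first by rewrite addeAC subee ?add0e.
  - exact/measurable_EFinP.
  - exact: mCg.
  - by move=> y; rewrite lee_fin; case/andP: (g01 y).
  - by move=> y; rewrite lee_fin subr_ge0; case/andP: (g01 y).
have meanE s : mean (two_point_law (p s)) = (-1) ^+ s * delta / 2.
  rewrite mean_two_point_law; [rewrite /p; lra|exact: p01].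
have mseE s B (h : n.-tuple R -> R) : measurable B ->
    (forall y, That y B = (h y)%:E) ->
    (forall t, B t ->
      delta ^+ 2 / 4 <= `|t - mean (two_point_law (p s))| ^+ 2) ->
    ((delta ^+ 2 / 4)%:E * released_expectation (two_point_law (p s)) M
      (EFin \o h) <= r%:E)%E.
  move=> mB hE tB; apply: le_trans (mse s).
  have dd0 : 0 <= delta ^+ 2 / 4 by rewrite mulr_ge0// sqr_ge0.
  have h0 y : (0 <= (h y)%:E)%E by rewrite -hE.
  have mh : measurable_fun setT (EFin \o h).
    rewrite (_ : _ \o _ = That ^~ B); first exact: measurable_kernel.
    by apply/funext => y /=; rewrite hE.
  rewrite -released_expectationZl//.
  apply: le_released_expectation.
  - exact: measurable_funeM.
  - exact: measurable_conditional_squared_error.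
  - move=> y; rewrite mule_ge0//=.
    by rewrite -hE; exact: markov_squared_error.
have tA t : A t -> delta ^+ 2 / 4 <= `|t - mean (two_point_law (p true))| ^+ 2.
  rewrite /A/= meanE expr1 real_normK ?num_real// => t0.
  have := mulr_ge0 t0 d0; have := sqr_ge0 t; lra.
have tAC t : (~` A) t ->
    delta ^+ 2 / 4 <= `|t - mean (two_point_law (p false))| ^+ 2.
  rewrite /A/= meanE expr0 real_normK ?num_real// => /negP.
  rewrite -ltNge => t0.
  have : 0 <= - t * delta by rewrite mulr_ge0// oppr_ge0 ltW.
  have := sqr_ge0 t; lra.
have := mseE true A g mA ThatA tA.
have := mseE false (~` A) _ (measurableC mA) ThatAC tAC.
rewrite xE (_ : EFin \o _ = fun y => (1 - g y)%:E)// xCE -!EFinM !lee_fin.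
have := released_second_moment eps01 Mp d01 mg g01.
rewrite (_ : (1 + delta) / 2 = p false); last by rewrite /p expr0 mul1r.
rewrite (_ : (1 - delta) / 2 = p true); last by rewrite /p expr1 mulN1r.
rewrite (xE false) => x2.
(* The exponent is at most 16 by the hypothesis on [delta], and [g^2 <= g] turns the second moment
   into a probability. *)
have {x2} : x false ^+ 2 <= expR 16 * x true.
  rewrite -lee_fin expr2 !EFinM -expe2 -(xE true).
  apply: (le_trans x2); apply: lee_pmul.
  - by rewrite lee_fin expR_ge0.
  - apply: released_expectation_ge0 => y; rewrite lee_fin mulr_ge0//;
      by case/andP: (g01 y).
  - by rewrite lee_fin ler_expR -mulrA -[leRHS]mulr1 ler_wpM2l.
  - apply: le_released_expectation.
    + by apply/measurable_EFinP; exact: measurable_funM.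
    + exact/measurable_EFinP.
    + move=> y; have /andP[g0 g1] := g01 y; rewrite !lee_fin mulr_ge0//=.
      by rewrite ler_piMr.
have K1 : 1 <= expR 16 :> R by rewrite -[leLHS]expR0 ler_expR.
rewrite ler_pdivrMr ?mulr_gt0 ?expR_gt0//.
have x0 : 0 <= x false.
  by rewrite fine_ge0//; apply: released_expectation_ge0 => y; rewrite lee_fin;
    case/andP: (g01 y).
move: (x false) (x true) x0 (expR 16) K1 => u v u0 K K1 uv h1 h2.
have dd0 := sqr_ge0 delta.
have r0 : 0 <= r * (K - 1).
  rewrite mulr_ge0 ?subr_ge0//.
  have v0 : 0 <= v.
    rewrite -(pmulr_rge0 _ (lt_le_trans ltr01 K1)).
    by apply: le_trans uv; exact: sqr_ge0.
  by apply: le_trans h2; rewrite mulr_ge0// divr_ge0.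
(* If [u < 1/2], the hypothesis of mean delta/2 already forces [r >= delta^2 / 8]. Otherwise
   [K v >= u^2 >= 1/4], and the other hypothesis gives the bound. *)
have [u_lt|u_ge] := ltP u 2^-1.
  have : 0 <= delta ^+ 2 * (2^-1 - u) by rewrite mulr_ge0// subr_ge0 ltW.
  lra.
have : 4^-1 <= K * v by apply: le_trans uv; nra.
move=> /(ler_wpM2l dd0).
have := ler_wpM2l (le_trans ler01 K1) h2.
lra.
Qed.

End lower_bound.

Lemma minimax_error_lower_bound (R : realType) n (eps : 'I_n -> R) :
  (forall i, 0 <= eps i <= 1) ->
  ((16 * expR 16)^-1%:E * Order.min ((\sum_(i < n) eps i ^+ 2)%:E^-1) 1
   <= minimax_error (@bounded_distributions R) (@mean R) eps)%E.
Proof.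
move=> eps01; set S := \sum_(i < n) _.
have S0 : 0 <= S by apply: sumr_ge0 => i _; exact: sqr_ge0.
(* The minimum is a real number even for [S = 0]: the extended inverse of 0 is +oo, so that
   [m = 1]. *)
have [m [m0 m1 mS minE]] : exists m : R, [/\ 0 <= m, m <= 1, m * S <= 1 &
    (Order.min (S%:E^-1) 1 = m%:E)%E].
  have [S_eq0|Sn0] := eqVneq S 0.
    exists 1; split; rewrite ?S_eq0 ?mulr0//.
    by rewrite inve0; apply/min_idPr; exact: leey.
  have Sgt0 : 0 < S by rewrite lt_neqAle eq_sym Sn0.
  exists (Num.min S^-1 1); split.
  - by rewrite le_min invr_ge0 S0 ler01.
  - by rewrite ge_min lexx orbT.
  - by rewrite -ler_pdivlMr// div1r ge_min lexx.
  - by rewrite inver (negbTE Sn0) EFin_min.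
rewrite minE -EFinM; apply: le_ereal_inf_tmp => _ [[M That] /= Mp <-].
set B := ereal_sup _.
pose delta := Num.sqrt m.
have delta2 : delta ^+ 2 = m by rewrite sqr_sqrtr.
have d01 : 0 <= delta <= 1 by rewrite sqrtr_ge0 -sqrtr1 ler_wsqrtr.
have mseB s : (mean_squared_error (@mean R) M That
    (two_point_law ((1 + (-1) ^+ s * delta) / 2)) <= B)%E.
  apply: ereal_sup_ubound; eexists; last by [].
  exact: bounded_two_point_law.
have B0 : (0 <= B)%E.
  apply: le_trans (mseB false); apply: released_expectation_ge0 => y.
  by apply: integral_ge0 => t _; rewrite lee_fin sqr_ge0.
(* An infinite worst-case error satisfies the bound trivially, and [B0] excludes -oo. *)
case: B B0 mseB => [r _ mser|_ _|//]; last by rewrite leey.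
rewrite lee_fin -delta2 mulrC.
by apply: (two_point_squared_error (That := That) eps01 Mp d01) => //;
  rewrite delta2.
Qed.

(** * Upper bound *)

Section density.
Context d (T : measurableType d) (R : realType).
Variables (mu nu : {measure set T -> \bar R}) (p : T -> \bar R).
Hypotheses (mp : measurable_fun setT p) (p0 : forall x, (0 <= p x)%E)
  (p_fin : forall x, p x \is a fin_num).
Hypothesis nuE : forall A, measurable A -> nu A = (\int[mu]_(x in A) p x)%E.
Local Open Scope ereal_scope.
Import HBNNSimple.

Let integral_density_nnsfun (h : {nnsfun T >-> R}) :
  \int[nu]_x (h x)%:E = \int[mu]_x ((h x)%:E * p x).
Proof.
rewrite integralT_nnsfun sintegralE.
under [RHS]eq_integral => x _.
  rewrite fimfunE -fsumEFin// ge0_mule_fsuml; last first.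
    by move=> r; rewrite EFinM nnfun_muleindic_ge0.
  over.
rewrite ge0_integral_fsum//; last 2 first.
- move=> r; apply: emeasurable_funM => //.
  by apply/measurable_EFinP; do 2 apply/measurableT_comp => //.
- by move=> r x _; rewrite mule_ge0// EFinM nnfun_muleindic_ge0.
apply: eq_fsbigr => r _.
have [r0|r0] := leP 0%R r; last first.
  rewrite preimage_nnfun0// measure0 mule0 integral0_eq// => x _.
  by rewrite indic0 mulr0 mul0e.
rewrite nuE//.
rewrite integral_mkcond -ge0_integralZl//; last 2 first.
- by apply/(measurable_restrictT _ _).1 => //; exact: measurable_funTS.
- by move=> x _; rewrite patchE; case: ifP.
apply: eq_integral => x _; rewrite EFinM -muleA; congr (_ * _).
by rewrite patchE indicE; case: ifP; rewrite ?mul1e ?mul0e.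
Qed.

(** The hypothesis [nuE] is the case of indicators; simple functions follow by linearity, and [f] by
    monotone convergence on both sides. *)
Lemma integral_density (f : T -> \bar R) :
  measurable_fun setT f -> (forall x, 0 <= f x) ->
  \int[nu]_x f x = \int[mu]_x (f x * p x).
Proof.
move=> mf f0; pose f_ := nnsfun_approx measurableT mf.
have f_nd x : {homo (fun n => (f_ n x)%:E) : m n / (m <= n)%N >-> m <= n}.
  by move=> m n mn; rewrite lee_fin; exact/lefP/nd_nnsfun_approx.
have f_cvg x : (f_ n x)%:E @[n --> \oo] --> f x.
  exact: cvg_nnsfun_approx.
transitivity (limn (fun n => \int[nu]_x (f_ n x)%:E)).
  rewrite -monotone_convergence//.
  - by apply: eq_integral => x _; exact/esym/cvg_lim.
  - by move=> n; exact/measurable_EFinP.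
  - by move=> n x _; rewrite lee_fin.
transitivity (limn (fun n => \int[mu]_x ((f_ n x)%:E * p x))).
  by congr (limn _); apply/funext => n; exact: integral_density_nnsfun.
rewrite -monotone_convergence//.
- apply: eq_integral => x _; apply/cvg_lim => //.
  exact: cvgeZr.
- by move=> n; apply: emeasurable_funM => //; exact/measurable_EFinP.
- by move=> n x _; rewrite mule_ge0// lee_fin.
- by move=> x _ m n mn; rewrite lee_wpmul2r//; exact: f_nd.
Qed.

End density.

Section lebesgue_invariance.
Context (R : realType).
Notation mu := (@lebesgue_measure R).

(** The pushforward of Lebesgue measure by [phi] agrees with it on half-open intervals, hence equals
    it by uniqueness. This covers translations and reflection. *)
Lemma lebesgue_integral_invariant (phi : R -> R) (f : R -> \bar R) :
  measurable_fun setT phi ->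
  (forall a b : R, a < b -> mu (phi @^-1` `]a, b]) = (b - a)%:E) ->
  measurable_fun setT f -> (forall x, 0 <= f x)%E ->
  (\int[mu]_x f (phi x) = \int[mu]_x f x)%E.
Proof.
move=> mphi phi_itv mf f0.
have mphi' : measurable_fun (setT : set (measurableTypeR R))
  (phi : measurableTypeR R -> measurableTypeR R) by exact: mphi.
pose nu : {measure set (measurableTypeR R) -> \bar R} :=
  pushforward mu (phi : measurableTypeR R -> measurableTypeR R).
transitivity (\int[nu mphi']_x f x)%E.
  by rewrite ge0_integral_pushforward// preimage_setT.
apply: eq_measure_integral => A mA _; apply/esym.
apply: lebesgue_measure_unique => // X.
move=> /ocitvP[->|[[a b] /= ab ->]]; first by rewrite !measure0.
rewrite lebesgue_measure_itv/= lte_fin ab -EFinB; exact/esym/phi_itv.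
Qed.

Lemma lebesgue_integral_shift (c : R) (f : R -> \bar R) :
  measurable_fun setT f -> (forall x, 0 <= f x)%E ->
  (\int[mu]_x f (c + x)%R = \int[mu]_x f x)%E.
Proof.
move=> mf f0; apply: (lebesgue_integral_invariant (phi := +%R c)) => //.
move=> a b ab; rewrite (_ : _ @^-1` _ = `]a - c, b - c]%classic).
  by rewrite lebesgue_measure_itv/= lte_fin ltrD2r ab -EFinB; congr EFin; ring.
by apply/seteqP; split => x /=; rewrite !in_itv/=; lra.
Qed.

Lemma lebesgue_integral_opp (f : R -> \bar R) :
  measurable_fun setT f -> (forall x, 0 <= f x)%E ->
  (\int[mu]_x f (- x)%R = \int[mu]_x f x)%E.
Proof.
move=> mf f0; apply: (lebesgue_integral_invariant (phi := -%R)) => //.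
move=> a b ab; rewrite (_ : _ @^-1` _ = `[- b, - a[%classic).
  by rewrite lebesgue_measure_itv/= lte_fin ltrN2 ab -EFinB; congr EFin; ring.
by apply/seteqP; split => x /=; rewrite !in_itv/=; lra.
Qed.

End lebesgue_invariance.

(** * Second moments of the Laplace law *)

Section laplace_integral.
Context (R : realType) (b : R) (b_gt0 : 0 < b).
Notation mu := (@lebesgue_measure R).

Lemma integral_laplace_law (f : R -> \bar R) :
  measurable_fun setT f -> (forall x, 0 <= f x)%E ->
  (\int[laplace_law b_gt0]_z f z = \int[mu]_z (f z * (laplace_pdf b z)%:E))%E.
Proof.
move=> mf f0.
(* R and [measurableTypeR R] have the same measurable sets but different
   displays: Lebesgue measure has to be transported along the identity. *)
have midR : measurable_fun (setT : set (measurableTypeR R))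
  (id : measurableTypeR R -> R) by exact: (@measurable_id _ R).
pose muR : {measure set R -> \bar R} :=
  pushforward mu (id : measurableTypeR R -> R).
have mpdf : measurable_fun setT (fun z => (laplace_pdf b z)%:E).
  by apply/measurable_EFinP; exact: measurable_laplace_pdf.
have pdf0 z : (0 <= (laplace_pdf b z)%:E)%E by rewrite lee_fin laplace_pdf_ge0.
have muRE (g : R -> \bar R) (A : set R) : measurable A ->
    measurable_fun setT g -> (forall z, 0 <= g z)%E ->
    (\int[muR midR]_(z in A) g z = \int[mu]_(z in A) g z)%E.
  move=> mA mg g0; rewrite ge0_integral_pushforward//.
  exact: measurable_funTS.
rewrite -muRE//; last 2 first.
- exact: emeasurable_funM.
- by move=> z; rewrite mule_ge0.
apply: integral_density => // A mA.
by rewrite muRE.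
Qed.

(* Since [u^2 / 2 <= exp u] with [u = |z| / (2 b)], [z^2] times the density of
   scale [b] is at most [16 b^2] times the density of scale [2 b]. *)
Lemma laplace_second_moment : (\int[mu]_z (z ^+ 2 * laplace_pdf b z)%:E <=
  (16 * b ^+ 2)%:E)%E.
Proof.
have b2 : 0 < 2 * b by rewrite mulr_gt0.
rewrite -[leRHS]mule1 -(integral_laplace_pdf b2) -ge0_integralZl//;
  last 3 first.
- by apply/measurable_EFinP; exact: measurable_laplace_pdf.
- by move=> z _; rewrite lee_fin laplace_pdf_ge0.
- by rewrite lee_fin mulr_ge0// sqr_ge0.
apply: ge0_le_integral => //.
- by move=> z _; rewrite lee_fin mulr_ge0 ?sqr_ge0// laplace_pdf_ge0.
- apply/measurable_EFinP; apply: measurable_funM; first exact: measurable_funX.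
  exact: measurable_laplace_pdf.
- apply: measurable_funeM.
  by apply/measurable_EFinP; exact: measurable_laplace_pdf.
move=> z _; rewrite -EFinM lee_fin /laplace_pdf.
set u := `|z| / (2 * b).
have u0 : 0 <= u by rewrite divr_ge0// ltW.
have zE : z ^+ 2 = 4 * b ^+ 2 * u ^+ 2.
  by rewrite /u -[z ^+ 2]real_normK ?num_real//; field; rewrite gt_eqF.
have -> : `|z| / b = u + u by rewrite /u; field; rewrite gt_eqF.
rewrite opprD expRD zE.
have u2 : u ^+ 2 * expR (- u) <= 2.
  have := expR_ge1Dxn 1 u0; rewrite /= => h.
  have : u ^+ 2 / 2 <= expR u by apply: le_trans h; rewrite lerDr.
  rewrite -(ler_pM2r (expR_gt0 (- u))) expRxMexpNx_1; lra.
have c0 : 0 <= 4 * b ^+ 2 * ((2 * b)^-1 * expR (- u)).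
  apply: mulr_ge0; first by rewrite mulr_ge0// sqr_ge0.
  by rewrite mulr_ge0 ?expR_ge0// invr_ge0 ltW.
have := ler_wpM2l c0 u2.
have -> : 16 * b ^+ 2 * ((2 * (2 * b))^-1 * expR (- u)) =
  4 * b ^+ 2 * ((2 * b)^-1 * expR (- u)) * 2.
  by field; rewrite gt_eqF.
by apply: le_trans; rewrite le_eqVlt; apply/orP; left; apply/eqP; ring.
Qed.

(** The noise is centred with second moment at most [16 b^2]. The shift [c] is arbitrary because it
    will absorb the contributions of the other users and the target. *)
Lemma laplace_squared_shift (w c : R) :
  (\int[laplace_law b_gt0]_z ((w * z + c) ^+ 2)%:E <=
   (c ^+ 2 + w ^+ 2 * (16 * b ^+ 2))%:E)%E.
Proof.
have msq (s : R) : measurable_fun setT (fun z : R => ((w * z + s) ^+ 2)%:E).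
  apply/measurable_EFinP; apply: measurable_funX; apply: measurable_funD => //.
have sq0 s z : (0 <= ((w * z + s) ^+ 2)%:E)%E by rewrite lee_fin sqr_ge0.
have mpdf : measurable_fun setT (laplace_pdf b).
  exact: measurable_laplace_pdf.
have mpdfE : measurable_fun setT (fun z => (laplace_pdf b z)%:E).
  exact/measurable_EFinP.
have pdf0 z : 0 <= laplace_pdf b z by exact: laplace_pdf_ge0.
pose J s := (\int[mu]_z (((w * z + s) ^+ 2)%:E * (laplace_pdf b z)%:E))%E.
have mJ s : measurable_fun setT
    (fun z => ((w * z + s) ^+ 2)%:E * (laplace_pdf b z)%:E)%E.
  exact: emeasurable_funM.
have J0 s z : (0 <= ((w * z + s) ^+ 2)%:E * (laplace_pdf b z)%:E)%E.
  by rewrite mule_ge0// lee_fin.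
rewrite integral_laplace_law// -/(J c).
(* By symmetry the cross term [2 w c z] integrates to 0, even though only
   integrals of nonnegative functions are manipulated here. *)
have JN : J (- c) = J c.
  apply: etrans (lebesgue_integral_opp (mJ c) (J0 c)).
  apply: eq_integral => z _; rewrite /laplace_pdf normrN.
  by congr (_%:E * _)%E; ring.
have JJ : (J c + J (- c)%R = \int[mu]_z ((2 * c ^+ 2)%:E * (laplace_pdf b z)%:E
    + (2 * w ^+ 2)%:E * (z ^+ 2 * laplace_pdf b z)%:E))%E.
  rewrite /J -ge0_integralD//; [|exact: mJ..].
  apply: eq_integral => z _.
  by rewrite -!EFinM -!EFinD; congr EFin; ring.
have c0 : 0 <= 2 * c ^+ 2 by rewrite mulr_ge0// sqr_ge0.
have w0 : 0 <= 2 * w ^+ 2 by rewrite mulr_ge0// sqr_ge0.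
have mz : measurable_fun setT (fun z : R => (z ^+ 2 * laplace_pdf b z)%:E).
  by apply/measurable_EFinP; apply: measurable_funM.
have z0 (z : R) : (0 <= (z ^+ 2 * laplace_pdf b z)%:E)%E.
  by rewrite lee_fin mulr_ge0// sqr_ge0.
have : (J c + J c <= (2 * (c ^+ 2 + w ^+ 2 * (16 * b ^+ 2)))%:E)%E.
  rewrite -{2}JN JJ ge0_integralD//; last 4 first.
  - by move=> z _; rewrite mule_ge0// lee_fin.
  - exact: measurable_funeM.
  - by move=> z _; rewrite mule_ge0// lee_fin.
  - exact: measurable_funeM.
  rewrite !ge0_integralZl ?lee_fin//; last by move=> z _; rewrite lee_fin.
  rewrite integral_laplace_pdf// mule1 mulrDr EFinD leeD2l//.
  rewrite mulrA [leRHS]EFinM lee_wpmul2l ?lee_fin//.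
  exact: laplace_second_moment.
have Jge0 : (0 <= J c)%E by apply: integral_ge0.
(* The bound on [J c + J c] rules out +oo, so that it can be halved in the reals. *)
case: (J c) Jge0 => [r _| |]//.
by rewrite -EFinD !lee_fin; lra.
Qed.

End laplace_integral.

(** * Privacy and error of the Laplace channel *)

Section laplace_channel_theory.
Context (R : realType).
Notation mu := (@lebesgue_measure R).

(** Moving the input from the event into the density lets the laws for two inputs be compared
    pointwise. *)
Lemma add_laplaceE (b : R) (b_gt0 : 0 < b) (x : R) (W : set R) :
  measurable W ->
  (add_laplace b_gt0 x W = \int[mu]_y (\1_W y * laplace_pdf b (y - x))%:E)%E.
Proof.
move=> mW; pose f (y : R) := (\1_W y * laplace_pdf b (y - x))%:E.
have mpdf : measurable_fun setT (fun y : R => laplace_pdf b (y - x)).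
  apply: (measurableT_comp (@measurable_laplace_pdf R b)).
  exact: measurable_funB.
have mf : measurable_fun setT f.
  by apply/measurable_EFinP; exact: measurable_funM.
have f0 y : (0 <= f y)%E by rewrite lee_fin mulr_ge0// laplace_pdf_ge0.
rewrite -[RHS](lebesgue_integral_shift x mf f0).
transitivity (\int[mu]_(z in +%R x @^-1` W) (laplace_pdf b z)%:E)%E => //.
rewrite integral_mkcond; apply: eq_integral => z _.
rewrite /f patchE indicE addrAC subrr add0r.
have -> : (z \in +%R x @^-1` W) = (x + z \in W) by apply/idP/idP; rewrite !inE.
by case: ifP; rewrite ?mul1r ?mul0r.
Qed.

Lemma laplace_pdf_shift_le (b x x' y : R) : 0 < b -> `|x - x'| <= 1 ->
  laplace_pdf b (y - x) <= expR b^-1 * laplace_pdf b (y - x').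
Proof.
move=> b0 xx'; rewrite /laplace_pdf mulrCA -expRD ler_wpM2l//.
  by rewrite invr_ge0 mulr_ge0// ltW.
have bV0 : 0 <= b^-1 by rewrite invr_ge0 ltW.
rewrite ler_expR; have := ler_normD (y - x) (x - x'); rewrite addrA subrK => h.
have /(ler_wpM2r bV0) : `|y - x'| <= `|y - x| + 1 by lra.
by rewrite mulrDl mul1r; lra.
Qed.

Lemma laplace_channel_private (eps : R) :
  0 <= eps -> locally_private eps (laplace_channel eps).
Proof.
move=> eps0 x x' hx hx' W mW; rewrite /laplace_channel.
have xx' : `|x - x'| <= 1.
  by move: hx hx'; rewrite /data_space/= !in_itv/= ler_norml; lra.
case: pselect => [eps_gt0|_]; last first.
  (* A silent user's output does not depend on the input, so only [exp(eps) >= 1] is needed. *)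
  by rewrite lee_pemull// lee_fin -[leLHS]expR0 ler_expR.
rewrite !add_laplaceE//.
have mpdf s : measurable_fun setT
    (fun y : R => (\1_W y * laplace_pdf eps^-1 (y - s))%:E).
  apply/measurable_EFinP; apply: measurable_funM => //.
  apply: (measurableT_comp (@measurable_laplace_pdf R eps^-1)).
  exact: measurable_funB.
have b0 : 0 < eps^-1 by rewrite invr_gt0.
have pdf0 s y : (0 <= (\1_W y * laplace_pdf eps^-1 (y - s))%:E)%E.
  by rewrite lee_fin mulr_ge0// laplace_pdf_ge0.
rewrite -ge0_integralZl ?lee_fin ?expR_ge0//; last exact: mpdf.
apply: ge0_le_integral => //.
- exact: mpdf.
- by apply: measurable_funeM; exact: mpdf.
move=> y _; rewrite -EFinM lee_fin (mulrCA (expR eps)) ler_wpM2l//.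
by have := laplace_pdf_shift_le y b0 xx'; rewrite invrK.
Qed.

Lemma laplace_channel_squared_shift (eps w c x : R) :
  0 <= eps -> (eps = 0 -> w = 0) ->
  (\int[laplace_channel eps x]_y ((w * y + c) ^+ 2)%:E <=
   ((w * x + c) ^+ 2 + w ^+ 2 * (16 / eps ^+ 2))%:E)%E.
Proof.
move=> eps0 w0; rewrite /laplace_channel.
have msq : measurable_fun setT (fun y : R => ((w * y + c) ^+ 2)%:E).
  by apply/measurable_EFinP; apply: measurable_funX; apply: measurable_funD.
case: pselect => [eps_gt0|neps]; last first.
  (* A silent user has weight 0, so its default output 0 creates no bias: both sides equal [c^2]. *)
  have w_eq0 : w = 0.
    by apply: w0; apply/eqP; rewrite eq_le eps0 andbT leNgt; exact/negP.
  rewrite w_eq0 in msq *; rewrite integral_dirac// diracE in_setT mul1e.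
  by rewrite expr0n/= !mul0r addr0 add0r.
rewrite ge0_integral_pushforward//; last by move=> y _; rewrite lee_fin sqr_ge0.
rewrite preimage_setT.
have := @laplace_squared_shift R _ (etrans (invr_gt0 eps) eps_gt0) w
  (w * x + c).
rewrite exprVn; apply: le_trans.
rewrite le_eqVlt; apply/orP; left; apply/eqP; apply: eq_integral => z _ /=.
by congr (_ ^+ 2)%:E; ring.
Qed.

End laplace_channel_theory.

(** * Bias and variance of linear estimators *)

Section linear_estimator_error.
Context (R : realType).

Lemma linear_combination_cons n (w : 'I_n.+1 -> R) (y0 : R) (y : n.-tuple R) :
  linear_combination w (tuple_cons (y0, y)) =
  w ord0 * y0 + linear_combination (fun i : 'I_n => w (lift ord0 i)) y.
Proof.
rewrite /linear_combination big_ord_recl; congr (_ + _).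
by apply: eq_bigr => i _; rewrite tnthS.
Qed.

Lemma measurable_linear_combination_sqr n (w : 'I_n -> R) (c : R) :
  measurable_fun setT (fun y => ((linear_combination w y + c) ^+ 2)%:E).
Proof.
apply/measurable_EFinP; apply: measurable_funX; apply: measurable_funD => //.
exact: measurable_linear_combination.
Qed.

(** Bounding the variance of each [w i * y] by [v i] in a form quantified over all shifts [c] makes
    the estimate additive over independent coordinates: the induction hypothesis is used with the
    first coordinate inside the shift. It serves once for the noise given the sample and once for
    the sample. *)
Lemma product_law_squared_shift n (mu : 'I_n -> probability R R)
    (w m v : 'I_n -> R) (c : R) :
  (forall i, 0 <= v i) ->
  (forall i c, (\int[mu i]_y ((w i * y + c) ^+ 2)%:E <=
    ((w i * m i + c) ^+ 2 + v i)%:E)%E) ->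
  (\int[product_law mu]_y ((linear_combination w y + c) ^+ 2)%:E <=
   ((\sum_(i < n) w i * m i + c) ^+ 2 + \sum_(i < n) v i)%:E)%E.
Proof.
elim: n => [|n IHn] in mu w m v c *; move=> v0 muE.
  rewrite /= integral_dirac//; last exact: measurable_linear_combination_sqr.
  by rewrite diracT mul1e /linear_combination !big_ord0 addr0.
have mF := measurable_linear_combination_sqr w c.
have F0 y : (0 <= ((linear_combination w y + c) ^+ 2)%:E)%E.
  by rewrite lee_fin sqr_ge0.
pose w' (i : 'I_n) := w (lift ord0 i).
pose mu' (i : 'I_n) := mu (lift ord0 i).
set s := \sum_(i < n.+1) _; set V := \sum_(i < n.+1) _.
have muE' (i : 'I_n) c' : (\int[mu' i]_y ((w' i * y + c') ^+ 2)%:E <=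
    ((w' i * m (lift ord0 i) + c') ^+ 2 + v (lift ord0 i))%:E)%E.
  exact: muE.
have IH y0 := IHn _ _ _ _ (w ord0 * y0 + c) (fun i => v0 (lift ord0 i)) muE'.
have V0 : 0 <= \sum_(i < n) v (lift ord0 i) by apply: sumr_ge0.
have sE : s = w ord0 * m ord0 + \sum_(i < n) w' i * m (lift ord0 i).
  exact: big_ord_recl.
have VE : V = v ord0 + \sum_(i < n) v (lift ord0 i) by exact: big_ord_recl.
rewrite integral_product_law_cons//.
move: (\sum_(i < n) w' i * m (lift ord0 i)) (\sum_(i < n) v (lift ord0 i))
  IH V0 sE VE.
move=> s' V' IH V0 -> ->.
have msq : measurable_fun setT
    (fun y0 : R => ((w ord0 * y0 + (s' + c)) ^+ 2)%:E).
  by apply/measurable_EFinP; apply: measurable_funX; apply: measurable_funD.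
apply: (@le_trans _ _
    (\int[mu ord0]_y0 (((w ord0 * y0 + (s' + c)) ^+ 2)%:E + V'%:E))%E).
  apply: ge0_le_integral => //.
  - by move=> y0 _; exact: integral_ge0.
  - have mG : measurable_fun setT ((fun y =>
        ((linear_combination w y + c) ^+ 2)%:E) \o @tuple_cons _ R n).
      by apply: measurableT_comp => //; exact: measurable_tuple_cons.
    exact: (@measurable_fun_fubini_tonelli_F _ _ _ _ _ (product_law mu') _ mG
      (fun z => F0 (tuple_cons z))).
  - exact: emeasurable_funD.
  - move=> y0 _; apply: le_trans; last first.
      rewrite -EFinD (_ : w ord0 * y0 + (s' + c) = s' + (w ord0 * y0 + c)).
        exact: IH.
      by ring.
    rewrite le_eqVlt; apply/orP; left; apply/eqP; apply: eq_integral => y _.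
    by rewrite linear_combination_cons; congr (_ ^+ 2)%:E; ring.
rewrite ge0_integralD//; last by move=> y0 _; rewrite lee_fin sqr_ge0.
rewrite integral_probability_cst (_ : _ + _ =
    ((w ord0 * m ord0 + (s' + c)) ^+ 2 + v ord0) + V').
  by rewrite EFinD leeD2r//; exact: muE.
by ring.
Qed.

(** The second moment of [clamp x] is at most 1, hence so is the variance. *)
Lemma bounded_squared_shift (P : probability R R) (w c : R) :
  bounded_distributions P ->
  (\int[P]_x ((w * x + c) ^+ 2)%:E <=
   ((w * mean P + c) ^+ 2 + w ^+ 2)%:E)%E.
Proof.
move=> Pb; rewrite (integral_clamp Pb); last first.
  by apply/measurable_EFinP; apply: measurable_funX; apply: measurable_funD.
rewrite (mean_clamp Pb).
have bc := bounded_measurable_clamp R.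
have bcc := bounded_measurableM bc bc.
have bs (s : R) := @bounded_measurable_cst _ R R s.
have b2 := bounded_measurableM (bs (w ^+ 2)) bcc.
have b1 := bounded_measurableM (bs (2 * w * c)) bc.
have b10 := bounded_measurableD b1 (bs (c ^+ 2)).
have cE (x : R) : (w * clamp x + c) ^+ 2 =
    w ^+ 2 * (clamp x * clamp x) + (2 * w * c * clamp x + c ^+ 2) by ring.
under eq_integral => x _ do rewrite cE.
rewrite -bounded_EFin_Rintegral; last exact: (bounded_measurableD b2 b10).
rewrite lee_fin (bounded_RintegralD _ b2 b10) (bounded_RintegralD _ b1 (bs _)).
rewrite !bounded_RintegralZl// Rintegral_probability_cst.
have : \int[P]_x (clamp x * clamp x) <= 1.
  rewrite -[leRHS](Rintegral_probability_cst P).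
  apply: le_Rintegral => //.
  - exact: (bounded_measurable_integrable P bcc).
  - exact: (bounded_measurable_integrable P (bs 1)).
  by move=> x _; have := clamp_bounds x; nra.
move/(ler_wpM2l (sqr_ge0 w)).
by have := sqr_ge0 (w * \int[P]_x clamp x); lra.
Qed.

Lemma linear_estimator_error n (eps w : 'I_n -> R) (P : probability R R) :
  (forall i, 0 <= eps i <= 1) -> (forall i, eps i = 0 -> w i = 0) ->
  \sum_(i < n) w i = 1 -> bounded_distributions P ->
  (mean_squared_error (@mean R) (laplace_mechanism eps) (linear_estimator w) P
   <= (\sum_(i < n) w i ^+ 2 * (1 + 16 / eps i ^+ 2))%:E)%E.
Proof.
move=> eps01 w0 w1 Pb; set theta := mean P.
pose v i := w i ^+ 2 * (16 / eps i ^+ 2).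
have v0 i : 0 <= v i by rewrite mulr_ge0 ?sqr_ge0// divr_ge0// sqr_ge0.
pose V := \sum_(i < n) v i.
have V0 : 0 <= V by apply: sumr_ge0.
have release_le (x : n.-tuple R) :
    (\int[release_law (laplace_mechanism eps) x]_y \int[linear_estimator w y]_t
      (`|t - theta| ^+ 2)%:E <=
     ((linear_combination w x - theta) ^+ 2 + V)%:E)%E.
  apply: le_trans (product_law_squared_shift (m := tnth x) (- theta) v0 _).
    rewrite le_eqVlt; apply/orP; left; apply/eqP; apply: eq_integral => y _.
    rewrite integral_dirac//.
      by rewrite diracE in_setT mul1e real_normK ?num_real.
    apply/measurable_EFinP; apply: measurable_funX.
    by apply: measurableT_comp => //; exact: measurable_funB.
  move=> i c; have /andP[e0 _] := eps01 i.
  exact: (laplace_channel_squared_shift c (tnth x i) e0 (w0 i)).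
have msq := measurable_linear_combination_sqr w (- theta).
apply: (@le_trans _ _ (\int[sample_law n P]_x
    (((linear_combination w x - theta) ^+ 2)%:E + V%:E))%E).
  apply: ge0_le_integral => //.
  - by move=> x _; apply: integral_ge0 => y _; apply: integral_ge0 => t _;
      rewrite lee_fin sqr_ge0.
  - apply: measurable_release_integral.
      exact: measurable_conditional_squared_error.
    by move=> y; apply: integral_ge0 => t _; rewrite lee_fin sqr_ge0.
  - exact: emeasurable_funD.
rewrite ge0_integralD//; last by move=> x _; rewrite lee_fin sqr_ge0.
rewrite (integral_probability_cst (sample_law n P)).
have := product_law_squared_shift (mu := fun=> P) (m := fun=> theta)
  (v := fun i => w i ^+ 2) (- theta) (fun i => sqr_ge0 _)
  (fun i c => bounded_squared_shift (w i) c Pb).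
(* The weights sum to 1, so the bias vanishes and only the variances remain. *)
rewrite -mulr_suml w1 mul1r subrr expr0n/= add0r => h.
apply: le_trans (leeD2r _ h) _; rewrite -EFinD lee_fin /V -big_split/=.
rewrite le_eqVlt; apply/orP; left; apply/eqP; apply: eq_bigr => i _.
by rewrite /v mulrDr mulr1.
Qed.

End linear_estimator_error.

Lemma laplace_estimator_upper_bound (R : realType) n (eps : 'I_n -> R) :
  (forall i, 0 <= eps i <= 1) -> (exists i, eps i != 0) ->
  exists w : 'I_n -> R,
    [/\ \sum_(i < n) w i = 1,
        forall i : 'I_n, eps i = 0 -> w i = 0,
        locally_private_mechanism eps (laplace_mechanism eps) &
        forall P : probability R R, bounded_distributions P ->
          (mean_squared_error (@mean R) (laplace_mechanism eps)
             (linear_estimator w) P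
           <= (17 / \sum_(i < n) eps i ^+ 2)%:E)%E].
Proof.
move=> eps01 [j ej]; set S := \sum_(i < n) _.
have S0 : 0 < S.
  rewrite /S (bigD1 j)//= ltr_pwDl//.
    by rewrite lt_neqAle eq_sym expf_neq0//= sqr_ge0.
  by apply: sumr_ge0 => i _; exact: sqr_ge0.
have Sn0 : S != 0 by rewrite gt_eqF.
(* Inverse-variance weighting up to constants: since [eps i <= 1], the variance factor
   [1 + 16 / eps i ^+ 2] of an active user is at most [17 / eps i ^+ 2]. *)
pose w i := eps i ^+ 2 / S.
have w0 i : eps i = 0 -> w i = 0 by move=> e0; rewrite /w e0 expr0n/= mul0r.
have w1 : \sum_(i < n) w i = 1 by rewrite -mulr_suml divff.
exists w; split => //.
  by move=> i; apply: laplace_channel_private; case/andP: (eps01 i).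
move=> P Pb; apply: le_trans (linear_estimator_error eps01 w0 w1 Pb) _.
rewrite lee_fin.
have -> : 17 / S = \sum_(i < n) 17 * eps i ^+ 2 / S ^+ 2.
  by rewrite -mulr_suml -mulr_sumr -/S; field.
apply: ler_sum => i _.
(* For a silent user [16 / eps i ^+ 2] is a default value, cancelled by the zero weight. *)
have [e_eq0|en0] := eqVneq (eps i) 0.
  by rewrite w0// e_eq0 expr0n/= !(mul0r, mulr0).
have /andP[e0 e1] := eps01 i.
rewrite (_ : w i ^+ 2 * _ =
    (eps i ^+ 2 * eps i ^+ 2 + 16 * eps i ^+ 2) / S ^+ 2).
  rewrite ler_wpM2r ?invr_ge0 ?sqr_ge0//.
  have : eps i ^+ 2 * eps i ^+ 2 <= eps i ^+ 2.
    by rewrite ler_piMr ?sqr_ge0// exprn_ile1.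
  lra.
by rewrite /w; field; rewrite Sn0.
Qed.

Unset Implicit Arguments.

Theorem theorem2 (R : realType) :
  exists l_l l_u : R, [/\ 0 < l_l, 0 < l_u &
    forall (n : nat) (eps : 'I_n -> R), (1 <= n)%N ->
      (forall i : 'I_n, 0 <= eps i <= 1) ->
      (l_l%:E * Order.min ((\sum_(i < n) eps i ^+ 2)%:E^-1) 1
         <= minimax_error (@bounded_distributions R) (@mean R) eps)%E
      /\
      ((exists i : 'I_n, eps i != 0) ->
       exists w : 'I_n -> R,
         [/\ \sum_(i < n) w i = 1,
             forall i : 'I_n, eps i = 0 -> w i = 0,
             locally_private_mechanism eps (laplace_mechanism eps) &
             forall P : probability R R, bounded_distributions P ->
               (mean_squared_error (@mean R) (laplace_mechanism eps)
                  (linear_estimator w) P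
                <= (l_u / \sum_(i < n) eps i ^+ 2)%:E)%E])].
Proof.
exists (16 * expR 16)^-1, 17.
split; [by rewrite invr_gt0 mulr_gt0// expR_gt0|by []|].
move=> n eps _ eps01.
split; first exact: minimax_error_lower_bound.
exact: laplace_estimator_upper_bound.
Qed.
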